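(* Let $G=(V,E)$ be a finite graph, $S\subseteq V$, and $s\in S$. Then $$|\mathsf{VC}(G,S)|\leq \left(\frac{2^{d(s)}}{1+2^{d(s)}}\right)|\mathsf{VC}(G,S\setminus\{s\})|.$$
   Context: A vertex cover of $G=(V,E)$ is a set $C\subseteq V$ such that $\{u,v\}\cap C\neq\emptyset$ for every edge $\{u,v\}\in E$. For $S\subseteq V$, $\mathsf{VC}(G,S)$ denotes the set of vertex covers of $G$ containing $S$. For a vertex $s$, $N_s$ is the set of neighbours of $s$ and $d(s)=|N_s|$. *)

(* Defs.v *)
From mathcomp Require Import all_boot all_order all_algebra.

Set Implicit Arguments.
Unset Strict Implicit.
Unset Printing Implicit Defensive.

(* A finite simple graph G = (V, E) is a finite type V of vertices with an
   adjacency relation e : rel V, assumed symmetric and irreflexive where used: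
   [e u v] means that {u, v} is an edge. *)

Definition vertex_cover (V : finType) (e : rel V) (C : {set V}) : bool :=
  [forall u, forall v, e u v ==> ([set u; v] :&: C != set0)].

Definition VC (V : finType) (e : rel V) (S : {set V}) : {set {set V}} :=
  [set C : {set V} | vertex_cover e C & S \subset C].

Definition nbrs (V : finType) (e : rel V) (s : V) : {set V} :=
  [set v | e s v].

Definition deg (V : finType) (e : rel V) (s : V) : nat := #|nbrs e s|.

(* Main.v *)
Require Import Defs.
From mathcomp Require Import all_boot all_order all_algebra.
Import Order.TTheory GRing.Theory Num.Theory.
Local Open Scope ring_scope.

(** Let [A] be the covers in VC(G, S \ {s}) that contain [s], i.e. VC(G, S), and
    [B] those that avoid [s].  Deleting [s] and adding all its neighbours sends
    [A] to [B]; a cover in [A] is recovered from its image together with its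
    trace on the neighbourhood of [s], so |A| <= 2^d(s) |B|. *)

Lemma vertex_coverP (V : finType) (e : rel V) (C : {set V}) :
  reflect (forall u v, e u v -> (u \in C) || (v \in C)) (vertex_cover e C).
Proof.
apply: (iffP forallP) => [H u v euv | H u].
  have /forallP/(_ v) := H u; rewrite euv /= => /set0Pn[x].
  by rewrite !inE => /andP[/orP[] /eqP-> ->]; rewrite ?orbT.
apply/forallP=> v; apply/implyP=> /H /orP[] hC; apply/set0Pn.
  by exists u; rewrite !inE eqxx.
by exists v; rewrite !inE eqxx orbT.
Qed.

Lemma VC_subset (V : finType) (e : rel V) (S T : {set V}) :
  S \subset T -> VC e T \subset VC e S.
Proof.
move=> sST; apply/subsetP=> C; rewrite !inE => /andP[-> /=].
exact: subset_trans.
Qed.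

(** Removing [s] can uncover only edges at [s], and the other end of each such edge lies in
    [nbrs e s]. *)
Lemma vertex_cover_swap (V : finType) (e : rel V) (C : {set V}) (s : V) :
  symmetric e -> vertex_cover e C -> vertex_cover e (C :\ s :|: nbrs e s).
Proof.
move=> e_sym /vertex_coverP hC; apply/vertex_coverP=> u v euv.
rewrite !inE; case: (eqVneq u s) => [<-|_]; first by rewrite euv !orbT.
case: (eqVneq v s) => [<-|_]; first by rewrite (e_sym v) euv !orbT.
by rewrite /= orbACA (hC _ _ euv).
Qed.

Lemma card_VC_le (V : finType) (e : rel V) (S : {set V}) (s : V) :
    symmetric e -> irreflexive e -> s \in S ->
  (#|VC e S| <= #|VC e (S :\ s) :\: VC e S| * 2 ^ deg e s)%N.
Proof.
move=> e_sym e_irr sS; set N := nbrs e s.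
pose f (C : {set V}) := (C :\ s :|: N, C :&: N).
(* Membership of [x] is read off the second component on [N] and off the first elsewhere, except at
   [s], which lies in both covers. *)
have f_inj : {in VC e S &, injective f}.
  move=> C D; rewrite !inE => /andP[_ /subsetP/(_ s sS) sC].
  move=> /andP[_ /subsetP/(_ s sS) sD] [/setP eqU /setP eqI]; apply/setP=> x.
  have := eqU x; have := eqI x; rewrite !inE.
  by case: (eqVneq x s) => [->|_]; rewrite ?sC ?sD //=; case: (e s x);
     rewrite ?andbT ?orbF.
(* With [2 ^ deg e s] counting the subsets of [N], the bound is the size of a product that contains
   the image of [f]. *)
rewrite -(card_in_imset f_inj) -card_powerset -cardsX.
apply/subset_leq_card/subsetP=> _ /imsetP[C + ->].
rewrite !inE subsetIr andbT /= => /andP[hC sSC].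
rewrite vertex_cover_swap //= (subset_trans (setSD _ sSC) (subsetUl _ _)) andbT.
(* The new cover misses [s]: irreflexivity keeps [s] out of [N], so it is not put back. *)
by apply/subsetPn; exists s; rewrite // !inE eqxx e_irr.
Qed.

Theorem theorem15 (V : finType) (e : rel V)
    (e_sym : symmetric e) (e_irr : irreflexive e)
    (S : {set V}) (s : V) (sS : s \in S) :
  (#|VC e S|%:R : rat) <=
    (2 ^+ deg e s / (1 + 2 ^+ deg e s)) * #|VC e (S :\ s)|%:R.
Proof.
have hle := card_VC_le V e S s e_sym e_irr sS.
have hsub : VC e S \subset VC e (S :\ s) by rewrite VC_subset ?subD1set.
rewrite -(cardsID (VC e S) (VC e (S :\ s))) (setIidPr hsub).
have pos : 0 < 1 + 2 ^+ deg e s :> rat by rewrite addr_gt0 ?exprn_gt0.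
(* With the denominator cleared, [2 ^+ deg e s * #|VC e S|] occurs on both sides; cancelling it
   leaves [hle]. *)
rewrite mulrAC ler_pdivlMr // mulrDr mulr1 natrD mulrDr.
rewrite [2 ^+ _ * #|VC e S|%:R]mulrC addrC lerD2l -natrX -natrM ler_nat.
by rewrite mulnC.
Qed.
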